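(* Let $S$ be a cancellative commutative semigroup. If $S$ is f-noetherian, then $S$ is countable.
   Context: A right congruence on a semigroup $S$ is an equivalence relation $\rho$ on $S$ such that $(a,b)\in\rho$ implies $(as,bs)\in\rho$ for all $s\in S$. The right congruence generated by a set $X\subseteq S\times S$ is the smallest right congruence on $S$ containing $X$; a right congruence is finitely generated if it is generated by some finite set $X$. The index of an equivalence relation is the cardinality of its set of equivalence classes. A semigroup $S$ is f-noetherian if every right congruence of finite index on $S$ is finitely generated. Countable means finite or countably infinite. *)

(* Defs.v *)
From Corelib Require Import RelationClasses.
From mathcomp Require Import all_boot.
From mathcomp Require Import classical_sets cardinality.

Set Implicit Arguments.
Unset Strict Implicit.
Unset Printing Implicit Defensive.

Local Open Scope classical_set_scope.
Local Open Scope group_scope.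

Definition cancellative (S : semigroupType) : Prop :=
  left_injective (fun a b : S => a * b) /\
  right_injective (fun a b : S => a * b).

Record right_congruence (S : semigroupType) (rho : set (S * S)) : Prop := {
  right_congruence_equiv : Equivalence (fun a b => rho (a, b));
  right_congruence_mul : forall a b s, rho (a, b) -> rho (a * s, b * s)
}.

(* [smallest] is defined as an intersection, so that it need not satisfy the
   given predicate in general; [right_congruence_smallest] below shows that
   here it does. *)
Definition generated_right_congruence (S : semigroupType) (X : set (S * S)) :
    set (S * S) :=
  smallest (@right_congruence S) X.

Lemma right_congruence_smallest (S : semigroupType) (X : set (S * S)) :
  right_congruence (generated_right_congruence X).
Proof.
split; first split.
- by move=> a R [[[refl _ _] _] _]; apply: refl.
- move=> a b ab R RX; case: (RX) => -[[_ sym _] _] _; exact: sym (ab R RX).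
- move=> a b c ab bc R RX; case: (RX) => -[[_ _ trans] _] _.
  by apply: trans (ab R RX) (bc R RX).
- move=> a b s ab R RX; case: (RX) => -[_ mulR] _; exact: mulR (ab R RX).
Qed.

Definition fg_right_congruence (S : semigroupType) (rho : set (S * S)) : Prop :=
  exists2 X : set (S * S), finite_set X & rho = generated_right_congruence X.

Definition equiv_classes (T : Type) (rho : set (T * T)) : set (set T) :=
  [set [set b | rho (a, b)] | a in [set: T]].

Definition finite_index (T : Type) (rho : set (T * T)) : Prop :=
  finite_set (equiv_classes rho).

Definition f_noetherian (S : semigroupType) : Prop :=
  forall rho : set (S * S),
    right_congruence rho -> finite_index rho -> fg_right_congruence rho.

(* Main.v *)
Require Import Defs.
From mathcomp Require Import all_boot.
From mathcomp Require Import classical_sets cardinality.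

(** The universal congruence on S has a single class, so it is generated by a
    finite set X of pairs. In the group of fractions of S this says that every
    quotient a / b lies in the subgroup generated by the finitely many
    quotients x / y with (x, y) in X, so that the group is finitely generated,
    hence countable, and S embeds in it.

    The argument below runs inside S. Let M be a subsemigroup containing all
    the entries of the pairs in X. The relation a * u = b * v for some u, v in
    M, which expresses that a / b is a quotient of two elements of M, is a
    congruence containing X ([fraction_right_congruence],
    [sub_fraction_relation]), so it relates any two elements of S. For a fixed
    b, cancellation recovers a from the pair (u, v), so S is countable as soon
    as M is. A countable M exists because finite products of elements of a
    countable set form a countable set ([countable_sub_mul_closed]). *)

Set Implicit Arguments.
Unset Strict Implicit.
Unset Printing Implicit Defensive.

Local Open Scope classical_set_scope.
Local Open Scope group_scope.

Lemma countable_image (T U : Type) (f : T -> U) (A : set T) :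
  countable A -> countable (f @` A).
Proof. by move=> cA; apply: sub_countable cA; apply: card_image_le. Qed.

Definition mul_closed (S : semigroupType) (M : set S) : Prop :=
  forall u v, M u -> M v -> M (u * v).

Fixpoint products (S : semigroupType) (A : set S) (n : nat) : set S :=
  if n is m.+1 then (fun p => p.1 * p.2) @` (A `*` products A m) else A.

(** The set [products A n] consists of the products of n + 1 factors, whence
   the index (m + n).+1. *)
Lemma products_mul (S : semigroupType) (A : set S) m n u v :
  products A m u -> products A n v -> products A (m + n).+1 (u * v).
Proof.
elim: m u => [|m IHm] u /=; first by move=> Au Av; exists (u, v).
case=> -[a w] /= [Aa Aw] <- Av; exists (a, w * v); last by rewrite /= mulgA.
by split=> //; exact: IHm Aw Av.
Qed.

Lemma countable_products (S : semigroupType) (A : set S) n :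
  countable A -> countable (products A n).
Proof.
by move=> cA; elim: n => //= n IHn; apply/countable_image/countableX.
Qed.

Lemma countable_sub_mul_closed (S : semigroupType) (A : set S) :
  countable A -> exists M : set S, [/\ A `<=` M, mul_closed M & countable M].
Proof.
move=> cA; exists (\bigcup_(n in [set: nat]) products A n); split.
- by move=> a Aa; exists 0.
- move=> u v [m _ Au] [n _ Av]; exists (m + n).+1 => //; exact: products_mul.
- by apply: bigcup_countable => // n _; apply: countable_products.
Qed.

(** In the group of fractions of a cancellative commutative semigroup, this
    says that a / b is a quotient of two elements of M. *)
Definition fraction_relation (S : semigroupType) (M : set S) : set (S * S) :=
  [set p | exists u v, [/\ M u, M v & p.1 * u = p.2 * v]].

(** Reflexivity needs an element of M; transitivity multiplies fractions: if
    a * u = b * v and b * u' = c * v' then a * (u * u') = c * (v' * v). *)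
Lemma fraction_right_congruence (S : semigroupType) (M : set S) :
  commutative (fun a b : S => a * b) -> M !=set0 -> mul_closed M ->
  right_congruence (fraction_relation M).
Proof.
move=> mulC [m Mm] Mmul; split; first split.
- by move=> a; exists m, m.
- by move=> a b [u [v [Mu Mv /= e]]]; exists v, u.
- move=> a b c [u [v [Mu Mv /= e]]] [u' [v' [Mu' Mv' /= e']]].
  exists (u * u'), (v' * v); split; [exact: Mmul | exact: Mmul |].
  by rewrite /= mulgA e -mulgA (mulC v) mulgA e' -mulgA.
- move=> a b s [u [v [Mu Mv /= e]]]; exists u, v; split=> //=.
  by rewrite -!mulgA !(mulC s) !mulgA e.
Qed.

Lemma sub_fraction_relation (S : semigroupType) (M : set S) (X : set (S * S)) :
  commutative (fun a b : S => a * b) ->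
  fst @` X `<=` M -> snd @` X `<=` M -> X `<=` fraction_relation M.
Proof.
move=> mulC X1M X2M [x y] Xxy; exists y, x; split=> /=; last exact: mulC.
- by apply: X2M; exists (x, y).
- by apply: X1M; exists (x, y).
Qed.

(** Once the denominator b is fixed, a fraction a / b = v / u determines its
    numerator a, so the pairs (u, v) in M parametrize the class of b. *)
Lemma countable_fraction_class (S : semigroupType) (M : set S) (b : S) :
  left_injective (fun a c : S => a * c) -> countable M ->
  countable [set a | fraction_relation M (a, b)].
Proof.
move=> mulI cM.
pose solutions (p : S * S) := [set a : S | a * p.1 = b * p.2].
have -> : [set a | fraction_relation M (a, b)] =
          \bigcup_(p in M `*` M) solutions p.
  rewrite eqEsubset; split=> a.
    by move=> [u [v [Mu Mv /= e]]]; exists (u, v).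
  by move=> [[u v] [/= Mu Mv] e]; exists u, v.
apply: bigcup_countable; first exact: countableX.
move=> [u v] _; have [->|/set0P[a0 e0]] := eqVneq (solutions (u, v)) set0.
  exact: finite_set_countable.
suff -> : solutions (u, v) = [set a0] by exact: countable1.
rewrite eqEsubset; split=> [a /= e|_ -> //].
by apply: (mulI u); rewrite /= e -e0.
Qed.

Lemma universal_right_congruence (S : semigroupType) :
  right_congruence [set: S * S].
Proof. by []. Qed.

Lemma universal_finite_index (T : Type) : finite_index [set: T * T].
Proof.
apply: (@sub_finite_set _ _ [set [set: T]]); last exact: finite_set1.
by move=> _ [a _ <-].
Qed.

Theorem proposition6p11 (S : semigroupType)
    (Scancel : cancellative S)
    (Scomm : commutative (fun a b : S => (a * b)%g))
    (Sfnoeth : f_noetherian S) :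
  countable [set: S]%classic.
Proof.
have [S0|/set0P[b _]] := eqVneq [set: S] set0; first by rewrite S0.
have [X finX XT] :=
  Sfnoeth _ (universal_right_congruence S) (@universal_finite_index S).
(* Adding b ensures that M is nonempty even when X is empty. *)
have [|M [AM Mmul cM]] :=
  @countable_sub_mul_closed S ([set b] `|` (fst @` X `|` snd @` X)).
  apply: finite_set_countable; rewrite !finite_setU.
  by split; [exact: finite_set1 | split; exact: finite_image].
have X1M : fst @` X `<=` M by move=> x Xx; apply: AM; right; left.
have X2M : snd @` X `<=` M by move=> x Xx; apply: AM; right; right.
have Mb : M !=set0 by exists b; apply: AM; left.
suff -> : [set: S] = [set a | fraction_relation M (a, b)].
  by apply: countable_fraction_class cM; case: Scancel.
rewrite eqEsubset; split=> // a _; rewrite /mkset.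
have : generated_right_congruence X (a, b) by rewrite -XT.
apply: smallest_sub; first exact: fraction_right_congruence.
exact: sub_fraction_relation.
Qed.
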